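(* The atomic gauges $M=\Gamma_{\mathcal{S}}$ and $M=\Gamma^\cup_{\mathcal{S}_+}$ satisfy strong monotonicity under $\mathcal{O}_{\mathrm{RNG}}$: for every $\rho\in\mathbb{D}$ and every set $\{K_n\}_n$ of Kraus operators of a quantum channel such that each map $K_n\cdot K_n^\dagger$ belongs to $\mathcal{O}_{\mathrm{RNG}}$, $$M(\rho)\ge\sum_n p_n\,M\!\left(\frac{K_n\rho K_n^\dagger}{p_n}\right),\qquad p_n=\mathrm{Tr}(K_n\rho K_n^\dagger).$$ Therefore they satisfy monotonicity under $\mathcal{O}_{\mathrm{SRNG}}$: $M(\rho)\ge M(\Lambda(\rho))$ for every $\rho\in\mathbb{D}$ and every completely positive trace-preserving $\Lambda\in\mathcal{O}_{\mathrm{SRNG}}$.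
   Context: Fix $d\ge 1$. $\mathcal{V}\subseteq\mathbb{C}^d$ is a nonempty compact set of unit vectors such that $|\psi\rangle\in\mathcal{V}$ implies $e^{i\theta}|\psi\rangle\in\mathcal{V}$ for all real $\theta$. $\mathbb{D}$ is the set of $d\times d$ density matrices. Put $\mathcal{S}_+=\{|v\rangle\langle v| : |v\rangle\in\mathcal{V}\}$, $\mathcal{S}=\{|v\rangle\langle w| : |v\rangle,|w\rangle\in\mathcal{V}\}\subseteq\mathbb{C}^{d\times d}$, and let $\mathcal{S}_+^{**}=\mathbb{R}_+\mathrm{conv}(\mathcal{S}_+)$ be the convex cone generated by $\mathcal{S}_+$. For a compact set $\mathcal{A}$ in a finite-dimensional vector space, the atomic gauge is $\Gamma_{\mathcal{A}}(x)=\inf\{\lambda\in\mathbb{R}_+ : x\in\lambda\,\mathrm{conv}(\mathcal{A})\}=\inf\{\sum_i c_i : x=\sum_i c_i a_i \text{ (finite sum)},\ a_i\in\mathcal{A},\ c_i\in\mathbb{R}_+\}$, with $\inf\emptyset=\infty$. The convex roof extension is $$\Gamma^\cup_{\mathcal{S}_+}(\rho)=\inf\Big\{\sum_i p_i\,\Gamma_{\mathcal{V}}(|\psi_i\rangle)^2 : \rho=\sum_i p_i|\psi_i\rangle\langle\psi_i|,\ \sum_i p_i=1,\ p_i\in\mathbb{R}_+\Big\}$$ over finite decompositions with $|\psi_i\rangle$ unit vectors. $\mathcal{O}_{\mathrm{RNG}}$ is the set of resource non-generating operations: completely positive linear maps $\Phi$ on $d\times d$ matrices (not necessarily trace-preserving)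 with $\sigma\in\mathcal{S}_+^{**}\Rightarrow\Phi(\sigma)\in\mathcal{S}_+^{**}$. $\mathcal{O}_{\mathrm{SRNG}}$ is the set of stochastically resource non-generating operations: maps $\Lambda$ admitting a Kraus decomposition $\Lambda(\rho)=\sum_n K_n\rho K_n^\dagger$ (finite sum) with $\sigma\in\mathcal{S}_+^{**}\Rightarrow K_n\sigma K_n^\dagger\in\mathcal{S}_+^{**}$ for all $n$. Kraus operators of a quantum channel satisfy $\sum_n K_n^\dagger K_n=\mathbb{1}$; terms with $p_n=0$ are omitted from the sum. *)

(* Defs.v *)
From HB Require Import structures.
From mathcomp Require Import all_boot all_order all_algebra.
From mathcomp Require Import all_classical all_reals all_analysis.
From mathcomp Require Import complex.

Set Implicit Arguments.
Unset Strict Implicit.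
Unset Printing Implicit Defensive.

Import Order.TTheory GRing.Theory Num.Theory.
Import numFieldNormedType.Exports.

Local Open Scope classical_set_scope.
Local Open Scope ring_scope.
Local Open Scope complex_scope.
Local Open Scope sesquilinear_scope.

(* Scalars are C = R[i] over a real field R. The order on R[i] is the partial
   one: 0 <= z means that z is real and nonnegative. Kets are column vectors,
   and ^t* is the conjugate transpose. Coefficients of convex and conic
   combinations are taken in R and embedded in R[i] by %:C. *)

Section Gauge.
Variables (R : realType) (E : lmodType R[i]).
Implicit Types (A : set E) (x : E) (t : R).

Definition conv A : set E :=
  [set x | exists k (c : 'I_k -> R) (a : 'I_k -> E),
     [/\ forall i, 0 <= c i, \sum_(i < k) c i = 1, forall i, A (a i)
       & x = \sum_(i < k) (c i)%:C *: a i]].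

Definition scale_set t A : set E := [set t%:C *: x | x in A].

Definition cone A : set E :=
  \bigcup_(t in [set t | 0 <= t]) scale_set t (conv A).

(* ereal_inf set0 = +oo. *)
Definition gauge A x : \bar R :=
  ereal_inf [set t%:E | t in [set t | 0 <= t /\ scale_set t (conv A) x]].

End Gauge.

Section Quantum.
Variables (R : realType) (d : nat).
Local Notation C := R[i].
Implicit Types (V : set 'cV[C]_d) (rho : 'M[C]_d) (Phi : 'M[C]_d -> 'M[C]_d).

Definition unit_vector (v : 'cV[C]_d) : Prop := v ^t* *m v = 1%:M.

Definition psd n (A : 'M[C]_n) : Prop :=
  A \is hermsymmx /\ forall x : 'cV[C]_n, 0 <= (x ^t* *m A *m x) 0 0.

Definition density rho : Prop := psd rho /\ \tr rho = 1.

Definition outer (v w : 'cV[C]_d) : 'M[C]_d := v *m w ^t*.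

(* The cast to R[i]^o selects the usual topology of C^d, that of the norm
   of R[i]. *)
Definition free_states V : Prop :=
  [/\ V !=set0,
      compact (V : set 'cV[C^o]_d),
      forall v, V v -> unit_vector v
    & forall v (t : R), V v -> V ((cos t +i* sin t) *: v)].

Definition Splus V : set 'M[C]_d := [set outer v v | v in V].

Definition S_ V : set 'M[C]_d := [set outer v w | v in V & w in V].

Definition convex_roof V rho : \bar R :=
  ereal_inf [set y | exists k (p : 'I_k -> R) (psi : 'I_k -> 'cV[C]_d),
    [/\ forall i, 0 <= p i, \sum_(i < k) p i = 1,
        forall i, unit_vector (psi i),
        rho = \sum_(i < k) (p i)%:C *: outer (psi i) (psi i)
      & y = (\sum_(i < k) (p i)%:E * gauge V (psi i) ^+ 2)%E]].

(* id_k (x) Phi, acting on a k x k matrix of d x d blocks. *)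
Definition ampliation Phi k (X : 'M[C]_(\sum_(i < k) d)) :
    'M[C]_(\sum_(i < k) d) :=
  \mxblock_(i < k, j < k)
    Phi (@submxblock C k k (fun=> d) (fun=> d) X i j).

Definition completely_positive Phi : Prop :=
  linear Phi /\
  forall k (X : 'M[C]_(\sum_(i < k) d)), psd X -> psd (ampliation Phi X).

Definition trace_preserving Phi : Prop := forall X, \tr (Phi X) = \tr X.

Definition cone_preserving V Phi : Prop :=
  forall sigma, cone (Splus V) sigma -> cone (Splus V) (Phi sigma).

Definition RNG V Phi : Prop := completely_positive Phi /\ cone_preserving V Phi.

Definition kraus_map (K : 'M[C]_d) : 'M[C]_d -> 'M[C]_d :=
  fun X => K *m X *m K ^t*.

Definition SRNG V Phi : Prop :=
  exists N (K : 'I_N -> 'M[C]_d),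
    (forall X, Phi X = \sum_(n < N) kraus_map (K n) X) /\
    (forall n, cone_preserving V (kraus_map (K n))).

Definition channel_kraus N (K : 'I_N -> 'M[C]_d) : Prop :=
  \sum_(n < N) (K n) ^t* *m K n = 1%:M.

(* The trace is real whenever rho is a density matrix. *)
Definition prob (K rho : 'M[C]_d) : R := complex.Re (\tr (kraus_map K rho)).

Definition strongly_monotone_RNG V (M : 'M[C]_d -> \bar R) : Prop :=
  forall rho, density rho ->
  forall N (K : 'I_N -> 'M[C]_d), channel_kraus K ->
  (forall n, RNG V (kraus_map (K n))) ->
  (\sum_(n < N | prob (K n) rho != 0%R)
     (prob (K n) rho)%:E *
       M ((prob (K n) rho)^-1%:C *: kraus_map (K n) rho)%R
   <= M rho)%E.

Definition monotone_SRNG V (M : 'M[C]_d -> \bar R) : Prop :=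
  forall rho, density rho ->
  forall Lambda, completely_positive Lambda -> trace_preserving Lambda ->
  SRNG V Lambda ->
  (M (Lambda rho) <= M rho)%E.

End Quantum.

(* Main.v *)
(* If K . K^* preserves the cone of S_+ and v is in V, then K v (K v)^* is a
   conic combination of projectors onto elements of V; having rank at most one,
   it forces K v = |K v| w with w in V. Hence a decomposition of rho into atoms
   is mapped by every K_n to a decomposition of K_n rho K_n^* into atoms, with
   weights multiplied by |K_n v| |K_n w|. Since sum_n |K_n v|^2 = 1, these
   factors sum over n to at most 1. For the convex roof the same argument for
   kets, with Jensen's inequality, gives
   sum_n Gamma_V(K_n psi)^2 <= Gamma_V(psi)^2. *)
Require Import Defs.
From mathcomp Require Import all_boot all_order all_algebra.
From mathcomp Require Import all_classical all_reals all_analysis.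
From mathcomp Require Import complex.
From mathcomp Require Import ring lra.

Set Implicit Arguments.
Unset Strict Implicit.
Unset Printing Implicit Defensive.

Import Order.TTheory GRing.Theory Num.Theory.

Local Open Scope classical_set_scope.
Local Open Scope ring_scope.
Local Open Scope complex_scope.
Local Open Scope sesquilinear_scope.

(** Bridges modulus one and the phases [cos t +i* sin t] under which [free_states] is closed. *)
Lemma unit_complex_polar (R : realType) (a b : R) :
  a ^+ 2 + b ^+ 2 = 1 -> exists t, a = cos t /\ b = sin t.
Proof.
move=> ab1.
have a1 : -1 <= a <= 1 by rewrite -ler_norml -(@expr_le1 _ 2)// real_normK ?num_real//; nra.
have sE : sin (acos a) = `|b|.
  by rewrite sin_acos// -sqrtr_sqr; congr Num.sqrt; lra.
have cE : cos (acos a) = a by rewrite acosK.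
(* The sine of [acos a] is never negative, so the sign of [b] selects the angle. *)
have [b0|b0] := leP 0 b; [exists (acos a)|exists (- acos a)].
  by rewrite sE cE ger0_norm.
by rewrite cosN sinN sE cE ltr0_norm// opprK.
Qed.

(** * Adjoints, squared norms and rank-one operators *)

Section Kets.
Variables (R : realType).
Local Notation C := R[i].

Lemma adjM m n p (A : 'M[C]_(m, n)) (B : 'M[C]_(n, p)) :
  (A *m B) ^t* = B ^t* *m A ^t*.
Proof. by rewrite trmx_mul map_mxM. Qed.

Lemma adjZ m n (a : C) (A : 'M[C]_(m, n)) : (a *: A) ^t* = a^*%R *: A ^t*.
Proof. by rewrite linearZ /= map_mxZ. Qed.

Lemma adjK m n (A : 'M[C]_(m, n)) : A ^t* ^t* = A.
Proof. by apply/matrixP => i j; rewrite !mxE conjCK. Qed.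

Lemma conj_rc (a : R) : ((a%:C)^*)%R = a%:C.
Proof. by rewrite conj_Creal// complex_real. Qed.

Variable d : nat.
Implicit Types (u v w : 'cV[C]_d) (K : 'M[C]_d).

Definition sqnorm u : R := complex.Re ((u ^t* *m u) 0 0).

Lemma sqnormE u : u ^t* *m u = (sqnorm u)%:C%:M.
Proof.
apply/matrixP => i j; rewrite !ord1 [RHS]mxE eqxx mulr1n /sqnorm RRe_real//.
apply: ger0_real; rewrite mxE; apply: sumr_ge0 => k _.
by rewrite !mxE mulrC mul_conjC_ge0.
Qed.

Lemma sqnorm_ge0 u : 0 <= sqnorm u.
Proof.
rewrite -lecR; have -> : (sqnorm u)%:C = (u ^t* *m u) 0 0.
  by rewrite sqnormE mxE eqxx mulr1n.
by rewrite mxE; apply: sumr_ge0 => k _; rewrite !mxE mulrC mul_conjC_ge0.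
Qed.

Lemma sqnorm_eq0 u : sqnorm u = 0 -> u = 0.
Proof.
move=> u0; have /matrixP/(_ 0 0) := sqnormE u; rewrite u0 !mxE/= mul0rn.
move/eqP; rewrite psumr_eq0 => [|k _]; last by rewrite !mxE mulrC mul_conjC_ge0.
move=> /allP h; apply/matrixP => k j; rewrite ord1 [RHS]mxE.
have := h k (mem_index_enum k); rewrite !mxE mulrC mul_conjC_eq0.
by move/eqP.
Qed.

Lemma sqnormZ (a : C) u : (sqnorm (a *: u))%:C = `|a| ^+ 2 * (sqnorm u)%:C.
Proof.
have /matrixP/(_ 0 0) := sqnormE (a *: u).
rewrite adjZ -scalemxAl -scalemxAr scalerA sqnormE !mxE eqxx !mulr1n => <-.
by rewrite normCK [a * _]mulrC.
Qed.

Lemma unit_vectorP u : unit_vector u <-> sqnorm u = 1.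
Proof.
rewrite /unit_vector; split => [|h]; last by rewrite sqnormE h.
by rewrite sqnormE => /matrixP/(_ 0 0); rewrite !mxE => -[].
Qed.

Lemma outerZ (a b : R) u v :
  outer (a%:C *: u) (b%:C *: v) = (a * b)%:C *: outer u v.
Proof. by rewrite /outer adjZ conj_rc -scalemxAl -scalemxAr scalerA rmorphM. Qed.

Lemma kraus_outer K u v : kraus_map K (outer u v) = outer (K *m u) (K *m v).
Proof. by rewrite /kraus_map /outer adjM !mulmxA. Qed.

Lemma kraus_sum K (I : finType) (c : I -> C) (X : I -> 'M[C]_d) :
  kraus_map K (\sum_i c i *: X i) = \sum_i c i *: kraus_map K (X i).
Proof.
rewrite /kraus_map mulmx_sumr mulmx_suml; apply: eq_bigr => i _.
by rewrite -scalemxAr -scalemxAl.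
Qed.

Lemma tr_outer u : \tr (outer u u) = (sqnorm u)%:C.
Proof. by rewrite /outer mxtrace_mulC sqnormE mxtrace_scalar mulr1n. Qed.

(** The completeness relation read as a quadratic form at [u]; all later estimates use
    [channel_kraus] through this identity. *)
Lemma channel_sqnorm N (K : 'I_N -> 'M[C]_d) u :
  channel_kraus K -> \sum_(n < N) sqnorm (K n *m u) = sqnorm u.
Proof.
move=> chK; apply: complexI; rewrite rmorph_sum /=.
transitivity ((u ^t* *m (\sum_(n < N) (K n) ^t* *m K n) *m u) 0 0).
  rewrite mulmx_sumr mulmx_suml summxE; apply: eq_bigr => n _.
  by rewrite mulmxA -mulmxA -adjM sqnormE mxE eqxx mulr1n.
by rewrite chK mulmx1 sqnormE mxE eqxx mulr1n.
Qed.

(** By cyclicity the hypothesis says that [A *m X] and [X] have the same trace for every [X];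
    testing on matrix units reads off the entries of [A]. *)
Lemma trace_preserving_channel N (K : 'I_N -> 'M[C]_d) :
  (forall X, \tr (\sum_(n < N) kraus_map (K n) X) = \tr X) -> channel_kraus K.
Proof.
move=> tp; rewrite /channel_kraus; set A := \sum_(n < N) (K n) ^t* *m K n.
have AE X : \tr (A *m X) = \tr X.
  rewrite -[RHS]tp /A mulmx_suml !raddf_sum /=; apply: eq_bigr => n _.
  by rewrite /kraus_map -mulmxA mxtrace_mulC.
apply/matrixP => i j; move: (AE (delta_mx j i)).
have trD (B : 'M[C]_d) : \tr (B *m delta_mx j i) = B i j.
  rewrite /mxtrace (bigD1 i)//= big1 ?addr0.
    rewrite mxE (bigD1 j)//= big1 ?addr0 => [|k kj]; rewrite mxE ?eqxx ?mulr1//.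
    by rewrite (negbTE kj) mulr0.
  by move=> k ki; rewrite mxE big1// => l _; rewrite mxE (negbTE ki) andbF mulr0.
by rewrite trD -[delta_mx j i]mul1mx trD.
Qed.

End Kets.

(** Decompositions are defined over ordinals, but merging the outcomes of a channel produces sums
    over pairs. *)
Lemma sum_enum_val (T : nmodType) (I : finType) (F : I -> T) :
  \sum_(k < #|I|) F (enum_val k) = \sum_i F i.
Proof. by rewrite -(@big_enum_val _ _ _ I predT F). Qed.

(** * Atomic gauges in a complex vector space *)

Section GaugeTheory.
Variables (R : realType) (E : lmodType R[i]).
Implicit Types (A : set E) (x : E).
Local Open Scope ereal_scope.

Lemma gauge_ge0 A x : 0 <= gauge A x.
Proof. by apply: le_ereal_inf_tmp => _ [t [t0 _] <-]; rewrite lee_fin. Qed.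

(** Dividing the coefficients by their sum turns a conic combination into a scaled convex one. *)
Lemma gauge_le A (I : finType) (c : I -> R) (a : I -> E) :
  A !=set0 -> (forall i, (0 <= c i)%R) -> (forall i, A (a i)) ->
  gauge A (\sum_i (c i)%:C *: a i)%R <= (\sum_i c i)%R%:E.
Proof.
move=> [a0 Aa0] c0 Aa; apply: ereal_inf_lbound; exists (\sum_i c i)%R => //.
have s0 : (0 <= \sum_i c i)%R by apply: sumr_ge0.
split=> //; have [s_eq0|s_neq0] := eqVneq (\sum_i c i)%R 0%R.
  (* With total weight 0 nothing can be normalised; every coefficient vanishes, and the point is 0
     times any atom. *)
  exists a0.
    exists 1%N, (fun=> 1%R), (fun=> a0); split => //.
      by rewrite big_ord1.
    by rewrite big_ord1 scale1r.
  rewrite s_eq0 scale0r big1// => i _; have /psumr_eq0P := s_eq0.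
  by move=> ->//; rewrite scale0r.
exists ((\sum_i c i)^-1%:C *: (\sum_i (c i)%:C *: a i))%R; last first.
  by rewrite scalerA -rmorphM divff// scale1r.
exists #|I|, (fun k => c (enum_val k) / \sum_i c i)%R, (a \o enum_val); split => //.
- by move=> k; apply: divr_ge0.
- by rewrite -mulr_suml (sum_enum_val c) divff.
- by move=> k /=.
- rewrite (sum_enum_val (fun i => (c i / \sum_i c i)%:C *: a i))%R scaler_sumr.
   apply: eq_bigr => i _.
  by rewrite scalerA -rmorphM mulrC.
Qed.

(** A decomposition of [s%:C *: x] divided by [s] decomposes [x]. This half of homogeneity removes
    the normalisation of output states. *)
Lemma gauge_pZ A (s : R) x : (0 < s)%R ->
  s%:E * gauge A x <= gauge A (s%:C *: x).
Proof.
move=> s0; apply: le_ereal_inf_tmp => _ [t [t0 [y Ay yx]] <-].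
have -> : t%:E = s%:E * (s^-1 * t)%:E by rewrite -EFinM mulVKf// gt_eqF.
apply: lee_wpmul2l; first by rewrite lee_fin ltW.
apply: ereal_inf_lbound; exists (s^-1 * t)%R => //; split.
  by rewrite mulr_ge0// invr_ge0 ltW.
exists y => //; rewrite rmorphM -scalerA yx scalerA -rmorphM mulVf ?gt_eqF//.
by rewrite scale1r.
Qed.

(** Squaring is increasing and continuous on nonnegative reals, so a bound on the square of every
    feasible scale passes to the square of the infimum. *)
Lemma gauge_sq_ge (B : \bar R) A x :
  (forall t : R, (0 <= t)%R -> scale_set t (Defs.conv A) x -> B <= (t ^+ 2)%:E) ->
  B <= gauge A x ^+ 2.
Proof.
move=> Bt; have [->|gy] := eqVneq (gauge A x) +oo.
  by rewrite expe2 mulyy leey.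
have gf : gauge A x \is a fin_num by rewrite ge0_fin_numE ?gauge_ge0// ltey.
have g0 := fine_ge0 (gauge_ge0 A x).
rewrite -(fineK gf) -EFin_expe leNgt; apply/negP => Bgt.
(* [B] may be infinite, so a real [b] replaces it; its square root exceeds the gauge and hence some
   feasible [t]. *)
have [b ltb bB] : exists2 b : R, (fine (gauge A x) ^+ 2 < b)%R & b%:E <= B.
  case: B Bgt {Bt} => [b| |]//; first by rewrite lte_fin => ?; exists b.
  by move=> _; exists (fine (gauge A x) ^+ 2 + 1)%R; rewrite ?leey// ltrDl.
have b0 : (0 <= b)%R by apply: le_trans (ltW ltb); rewrite exprn_ge0.
have : gauge A x < (Num.sqrt b)%:E.
  rewrite -(fineK gf) lte_fin -(@ltr_pXn2r _ 2) ?nnegrE ?sqrtr_ge0//.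
  by rewrite sqr_sqrtr.
move=> /ereal_inf_lt[_ [t [t0 At] <-]]; rewrite lte_fin => tb.
have := le_trans bB (Bt _ t0 At); rewrite lee_fin leNgt => /negP; apply.
by rewrite -(sqr_sqrtr b0) ltr_pXn2r ?nnegrE ?sqrtr_ge0.
Qed.

End GaugeTheory.

(** * Rank-one elements of the cone of free states *)

Section FreeStates.
Variables (R : realType) (d : nat) (V : set 'cV[R[i]]_d).
Hypothesis hV : free_states V.
Local Notation C := R[i].
Implicit Types (u v w x : 'cV[C]_d) (K : 'M[C]_d).

Lemma free_unit v : V v -> unit_vector v.
Proof. by case: hV => _ _ + _; apply. Qed.

Lemma free_phase v (z : C) : `|z| = 1 -> V v -> V (z *: v).
Proof.
case: hV => _ _ _ ph z1 Vv.
have : complex.Re z ^+ 2 + complex.Im z ^+ 2 = 1.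
  by apply: complexI; rewrite add_Re2_Im2 z1 expr1n.
move=> /unit_complex_polar[t [ct st]].
have -> : z = cos t +i* sin t by rewrite -ct -st; case: (z).
exact: ph.
Qed.

Lemma cone_outer u : cone (Splus V) (outer u u) ->
  exists2 w, V w & u = (Num.sqrt (sqnorm u))%:C *: w.
Proof.
have [->|u0] := eqVneq u 0.
  have [[w Vw] _ _ _] := hV; exists w => //.
  suff -> : sqnorm (0 : 'cV[C]_d) = 0 by rewrite sqrtr0 scale0r.
  by rewrite /sqnorm mulmx0 mxE.
have su0 : sqnorm u != 0 by apply: contra u0 => /eqP/sqnorm_eq0 ->.
case=> t /= t0 [_ [k [c [a [c0 _ Sa ->]]]] uE].
have /choice[w wP] : forall i, exists w, V w /\ a i = outer w w.
  by move=> i; have [w Vw <-] := Sa i; exists w.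
have uwE : outer u u = \sum_i (t * c i)%:C *: outer (w i) (w i).
  rewrite -uE scaler_sumr; apply: eq_bigr => i _.
  by rewrite scalerA -rmorphM (wP i).2.
(* If all weights vanished, so would the trace of [outer u u], which is [sqnorm u]. *)
have [i tc0] : exists i, t * c i != 0.
  apply: contrapT => h; move/eqP: su0; apply; apply: complexI.
  rewrite -tr_outer uwE big1 ?raddf0// => i _.
  have [->|/eqP tc0] := eqVneq (t * c i) 0; first by rewrite scale0r.
  by case: h; exists i; apply/eqP.
(* Every x orthogonal to u is orthogonal to w i, because all the terms of
   0 = x^* u u^* x = sum_j t c_j |w_j^* x|^2 vanish. *)
have wort x : u ^t* *m x = 0 -> (w i) ^t* *m x = 0.
  move=> ux; have : (x ^t* *m outer u u *m x) 0 0 = 0.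
    by rewrite /outer -!mulmxA ux !mulmx0 mxE.
  rewrite uwE mulmx_sumr mulmx_suml summxE => /eqP.
  have tE j : (x ^t* *m ((t * c j)%:C *: outer (w j) (w j)) *m x) 0 0 =
      (t * c j)%:C * `|((w j) ^t* *m x) 0 0| ^+ 2.
    rewrite -scalemxAr -scalemxAl mxE; congr (_ * _).
    rewrite /outer -!mulmxA mulmxA -[x ^t* *m w j]adjK adjM adjK.
    by rewrite mxE big_ord1 normCK !mxE mulrC.
  rewrite psumr_eq0 => [/allP/(_ i (mem_index_enum i))|j _]; rewrite tE.
    rewrite mulf_eq0 sqrf_eq0 normr_eq0 eq_complex /= (negbTE tc0)/= => /eqP wx.
    by apply/matrixP => p q; rewrite !ord1 wx mxE.
  by rewrite mulr_ge0 ?exprn_ge0// ler0c mulr_ge0.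
(* [al] is the coefficient of the orthogonal projection of [w i] on [u]. The remainder is orthogonal
   to [u], hence by [wort] to [w i], hence to itself. *)
have [al wE] : exists al, w i = al *: u.
  exists ((u ^t* *m w i) 0 0 / (sqnorm u)%:C).
  set al := _ / _; apply/eqP; rewrite -subr_eq0; apply/eqP/sqnorm_eq0.
  have ux : u ^t* *m (w i - al *: u) = 0.
    rewrite mulmxBr -scalemxAr sqnormE scale_scalar_mx divfK.
      by rewrite -mx11_scalar subrr.
    by rewrite eq_complex /= negb_and su0.
  rewrite /sqnorm; set y := w i - _ in ux *.
  have -> : y ^t* = (w i) ^t* - al^*%R *: u ^t*.
    by rewrite /y -adjZ; apply/matrixP => p q; rewrite !mxE rmorphB.
  by rewrite mulmxBl -scalemxAl ux wort// scaler0 subr0 mxE.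
have /unit_vectorP w1 := free_unit (wP i).1.
have nE : `|al| ^+ 2 * (sqnorm u)%:C = 1 by rewrite -sqnormZ -wE w1.
have sE : ((Num.sqrt (sqnorm u))%:C) ^+ 2 = (sqnorm u)%:C.
  by rewrite -rmorphXn sqr_sqrtr// sqnorm_ge0.
have [s0 al0] : (Num.sqrt (sqnorm u))%:C != 0 :> C /\ al != 0.
  split; last by apply: contra_eq_neq nE => ->; rewrite normr0 expr0n mul0r eq_sym oner_eq0.
  by apply: contra_eq_neq nE => s0; rewrite -sE s0 expr0n mulr0 eq_sym oner_eq0.
(* Since [w i] is a unit vector, [al] times the norm of [u] has modulus one; removing this phase
   stays in [V]. *)
exists ((al * (Num.sqrt (sqnorm u))%:C)^-1 *: w i); last first.
  by rewrite wE !scalerA mulrAC [_ * al]mulrC divff ?scale1r ?mulf_neq0.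
apply: free_phase (wP i).1; apply/eqP; rewrite normfV invr_eq1.
by rewrite -(@pexpr_eq1 _ _ 2)// normrM exprMn [`|_%:C|]ger0_norm ?ler0c ?sqrtr_ge0// sE nE.
Qed.

Lemma free_image K v : cone_preserving V (kraus_map K) -> V v ->
  exists2 w, V w & K *m v = (Num.sqrt (sqnorm (K *m v)))%:C *: w.
Proof.
move=> Kc Vv; apply: cone_outer; rewrite -kraus_outer; apply: Kc.
exists 1 => //=; exists (outer v v); last by rewrite scale1r.
exists 1%N, (fun=> 1), (fun=> outer v v); split=> //.
- by rewrite big_ord1.
- by move=> _; exists v.
- by rewrite big_ord1 scale1r.
Qed.

End FreeStates.

(** Each diagonal entry of the image is the quadratic form of [rho] at the adjoint of [K] applied to
    a basis vector. *)
Lemma prob_ge0 (R : realType) d (K rho : 'M[R[i]]_d) :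
  density rho -> 0 <= prob K rho.
Proof.
case=> -[_ rho_ge0] _; suff : 0 <= \tr (kraus_map K rho).
  by rewrite lecE => /andP[].
apply: sumr_ge0 => j _; have := rho_ge0 (K ^t* *m delta_mx j 0).
have -> : (K ^t* *m delta_mx j 0 : 'cV[R[i]]_d) ^t* = delta_mx 0 j *m K.
  rewrite adjM adjK; congr (_ *m _).
  by apply/matrixP => p q; rewrite !mxE andbC conj_Creal// realn.
have -> : delta_mx 0 j *m K *m rho *m (K ^t* *m delta_mx j 0) =
    row j (col j (kraus_map K rho)) by rewrite colE rowE /kraus_map !mulmxA.
by rewrite !mxE.
Qed.

(** The gap between the two sides is the variance of [x] about its mean [m]. *)
Lemma sqr_convex_comb_le (R : realType) (I : finType) (c x : I -> R) :
  (forall i, 0 <= c i) -> \sum_i c i = 1 ->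
  (\sum_i c i * x i) ^+ 2 <= \sum_i c i * x i ^+ 2.
Proof.
move=> c0 c1; set m := \sum_i c i * x i; rewrite -subr_ge0.
have -> : \sum_i c i * x i ^+ 2 - m ^+ 2 = \sum_i c i * (x i - m) ^+ 2.
  transitivity (\sum_i (c i * x i ^+ 2 - m *+ 2 * (c i * x i) + m ^+ 2 * c i)).
    rewrite big_split sumrB -!mulr_sumr /= c1 -/m; ring.
  by apply: eq_bigr => i _; ring.
by apply: sumr_ge0 => i _; rewrite mulr_ge0 ?sqr_ge0.
Qed.

(** * Transport of decompositions through the Kraus operators *)

Section Monotonicity.
Variables (R : realType) (d : nat) (V : set 'cV[R[i]]_d).
Hypothesis hV : free_states V.
Variables (N : nat) (K : 'I_N -> 'M[R[i]]_d).
Hypothesis chK : channel_kraus K.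
Hypothesis coneK : forall n, cone_preserving V (kraus_map (K n)).
Local Notation C := R[i].
Implicit Types (psi v w : 'cV[C]_d) (rho : 'M[C]_d).

Let len n v : R := Num.sqrt (sqnorm (K n *m v)).

Let len_ge0 n v : 0 <= len n v. Proof. exact: sqrtr_ge0. Qed.

Let sum_len_sq v : \sum_n len n v ^+ 2 = sqnorm v.
Proof.
by rewrite -(channel_sqnorm _ chK); apply: eq_bigr => n _; rewrite sqr_sqrtr// sqnorm_ge0.
Qed.

Let free_images : exists f : 'I_N -> 'cV[C]_d -> 'cV[C]_d,
  forall n v, V v -> V (f n v) /\ K n *m v = (len n v)%:C *: f n v.
Proof.
have /choice[f fP] : forall nv : 'I_N * 'cV[C]_d, exists w, V nv.2 ->
    V w /\ K nv.1 *m nv.2 = (len nv.1 nv.2)%:C *: w.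
  (* Outside [V] the requirement is vacuous, and [v] serves as a default. *)
  move=> [n v] /=; have [Vv|nVv] := pselect (V v); last by exists v.
  by have [w Vw wE] := free_image hV (coneK n) Vv; exists w.
by exists (fun n v => f (n, v)) => n v; exact: (fP (n, v)).
Qed.

(** Each product is at most the mean of the two squares, and both families of squares sum to 1. *)
Lemma sum_len_mul_le v w : V v -> V w -> \sum_n len n v * len n w <= 1.
Proof.
move=> /(free_unit hV)/unit_vectorP v1 /(free_unit hV)/unit_vectorP w1.
apply: (@le_trans _ _ (\sum_n (len n v ^+ 2 + len n w ^+ 2) / 2)).
  by apply: ler_sum => n _; have := sqr_ge0 (len n v - len n w); nra.
by rewrite -mulr_suml big_split /= !sum_len_sq v1 w1; lra.
Qed.

(** Keeping the outcomes [n] separate under one total bound serves both results: strong monotonicity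
    treats each outcome alone, plain monotonicity merges them. *)
Lemma S_decomposition_kraus rho t : 0 <= t -> scale_set t (Defs.conv (S_ V)) rho ->
  exists (I : finType) (c : 'I_N -> I -> R) (a : 'I_N -> I -> 'M[C]_d),
    [/\ forall n i, 0 <= c n i, forall n i, S_ V (a n i),
        forall n, kraus_map (K n) rho = \sum_i (c n i)%:C *: a n i
      & \sum_n \sum_i c n i <= t].
Proof.
move=> t0 [_ [k [c [a [c0 c1 Sa ->]]]] <-].
have [f fP] := free_images.
have /choice[vw vwP] : forall i, exists vw, [/\ V vw.1, V vw.2 & a i = outer vw.1 vw.2].
  by move=> i; have [v Vv [w Vw <-]] := Sa i; exists (v, w).
pose v i := (vw i).1; pose w i := (vw i).2.
have Vv i : V (v i) by case: (vwP i).
have Vw i : V (w i) by case: (vwP i).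
exists 'I_k, (fun n i => t * c i * (len n (v i) * len n (w i))),
  (fun n i => outer (f n (v i)) (f n (w i))); split => //.
- by move=> n i; rewrite !mulr_ge0.
- by move=> n i; exists (f n (v i)); [apply: (fP _ _ _).1|exists (f n (w i)) => //; apply: (fP _ _ _).1].
- move=> n; rewrite scaler_sumr.
  under eq_bigr do rewrite scalerA -rmorphM.
  rewrite kraus_sum; apply: eq_bigr => i _.
  have [_ _ ->] := vwP i.
  rewrite kraus_outer (fP n (v i) (Vv i)).2 (fP n (w i) (Vw i)).2 outerZ.
  by rewrite scalerA -rmorphM.
rewrite exchange_big /= -[leRHS]mulr1 -c1 mulr_sumr; apply: ler_sum => i _.
by rewrite -mulr_sumr -[leRHS]mulr1 ler_wpM2l ?mulr_ge0// sum_len_mul_le.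
Qed.

Local Open Scope ereal_scope.

Lemma sum_gauge_sq_kraus psi :
  \sum_(n < N) gauge V (K n *m psi) ^+ 2 <= gauge V psi ^+ 2.
Proof.
apply: gauge_sq_ge => t t0 [_ [k [c [v [c0 c1 Vv ->]]]] <-].
have [f fP] := free_images.
(* [g n] is the total weight of the decomposition of [K n *m psi] obtained by mapping each atom. *)
pose g n := (t * \sum_i c i * len n (v i))%R.
have g0 n : (0 <= g n)%R.
  by rewrite mulr_ge0// sumr_ge0// => i _; rewrite mulr_ge0.
apply: (@le_trans _ _ (\sum_(n < N) (g n ^+ 2)%R%:E)).
  apply: lee_sum => n _; rewrite EFin_expe !expe2.
  suff h : gauge V (K n *m (t%:C *: \sum_i (c i)%:C *: v i))%R <= (g n)%:E.
    by apply: lee_pmul => //; exact: gauge_ge0.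
  have -> : (K n *m (t%:C *: \sum_i (c i)%:C *: v i) =
      \sum_i (t * (c i * len n (v i)))%:C *: f n (v i))%R.
    rewrite -scalemxAr mulmx_sumr scaler_sumr; apply: eq_bigr => i _.
    by rewrite -scalemxAr (fP n _ (Vv i)).2 !scalerA -!rmorphM mulrA.
  rewrite /g mulr_sumr; apply: gauge_le.
  - by case: hV.
  - by move=> i; rewrite !mulr_ge0.
  - by move=> i; exact: (fP _ _ _).1.
rewrite sumEFin lee_fin.
(* Jensen with weights [c i] moves the square onto the lengths, whose squares sum over [n] to 1 for
   each atom. *)
apply: (@le_trans _ _ (\sum_n t ^+ 2 * \sum_i c i * len n (v i) ^+ 2)%R).
  apply: ler_sum => n _; rewrite exprMn ler_wpM2l ?sqr_ge0//.
  exact: sqr_convex_comb_le.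
rewrite -mulr_sumr exchange_big /= -[leRHS]mulr1 ler_wpM2l ?sqr_ge0// -c1.
apply: ler_sum => i _; rewrite -mulr_sumr sum_len_sq.
by have /unit_vectorP -> := free_unit hV (Vv i); rewrite mulr1.
Qed.

(** The kets [psi i] need not be free, so their images are only normalised, and the cost is
    controlled by [sum_gauge_sq_kraus]. The condition that [q] sums to [p] over [n] makes the merged
    family a convex decomposition again. *)
Lemma roof_decomposition_kraus rho k (p : 'I_k -> R) (psi : 'I_k -> 'cV[C]_d) :
  (forall i, (0 <= p i)%R) -> (forall i, unit_vector (psi i)) ->
  rho = (\sum_(i < k) (p i)%:C *: outer (psi i) (psi i))%R ->
  exists (q : 'I_N -> 'I_k -> R) (phi : 'I_N -> 'I_k -> 'cV[C]_d),
    [/\ forall n i, (0 <= q n i)%R, forall n i, unit_vector (phi n i),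
        forall n, kraus_map (K n) rho =
          (\sum_(i < k) (q n i)%:C *: outer (phi n i) (phi n i))%R,
        forall i, (\sum_(n < N) q n i)%R = p i
      & \sum_(n < N) \sum_(i < k) (q n i)%:E * gauge V (phi n i) ^+ 2 <=
        \sum_(i < k) (p i)%:E * gauge V (psi i) ^+ 2].
Proof.
move=> p0 psi1 ->.
(* When K n kills psi i, the weight is 0 and any unit vector will do. *)
pose phi n i := if len n (psi i) == 0%R then psi i
                else ((len n (psi i))^-1%:C *: (K n *m psi i))%R.
have phiE n i : (K n *m psi i = (len n (psi i))%:C *: phi n i)%R.
  rewrite /phi; case: eqVneq => [l0|l0].
    rewrite l0 scale0r; apply: sqnorm_eq0; apply/eqP.
    by rewrite eq_le sqnorm_ge0 andbT -sqrtr_eq0; apply/eqP.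
  by rewrite scalerA -rmorphM divff// scale1r.
have phi1 n i : unit_vector (phi n i).
  rewrite /phi; case: eqVneq => [//|l0]; apply/unit_vectorP/complexI.
  rewrite sqnormZ -(sqr_sqrtr (sqnorm_ge0 (K n *m psi i))) rmorphXn -exprMn.
  rewrite ger0_norm ?ler0c ?invr_ge0// -rmorphM mulVf// expr1n//.
exists (fun n i => p i * len n (psi i) ^+ 2)%R, phi; split => //.
- by move=> n i; rewrite mulr_ge0 ?sqr_ge0.
- move=> n; rewrite kraus_sum; apply: eq_bigr => i _.
  by rewrite kraus_outer phiE outerZ scalerA -rmorphM expr2.
- move=> i; rewrite -mulr_sumr sum_len_sq.
  by have /unit_vectorP -> := psi1 i; rewrite mulr1.
rewrite exchange_big /=; apply: lee_sum => i _.
have sq0 (x : \bar R) : 0 <= x -> 0 <= x ^+ 2 by move=> x0; rewrite expe2 mule_ge0.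
apply: (@le_trans _ _ (\sum_(n < N) (p i)%:E * gauge V (K n *m psi i)%R ^+ 2)).
  apply: lee_sum => n _; rewrite EFinM -muleA.
  apply: lee_wpmul2l; first by rewrite lee_fin.
  have [l0|l0] := eqVneq (len n (psi i)) 0%R.
    (* A zero weight contributes 0 even against an infinite gauge, since 0 times [+oo] is 0. *)
    by rewrite l0 expr0n /= mul0e sq0// gauge_ge0.
  have lpos : (0 < len n (psi i))%R by rewrite lt_def l0 len_ge0.
  rewrite EFin_expe !expe2 muleACA phiE.
  by apply: lee_pmul; rewrite ?mule_ge0 ?lee_fin ?gauge_ge0// gauge_pZ.
rewrite -ge0_sume_distrr => [|n _]; last by rewrite sq0// gauge_ge0.
by apply: lee_wpmul2l; rewrite ?lee_fin// sum_gauge_sq_kraus.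
Qed.

End Monotonicity.

(** * Monotonicity of the gauge and of the convex roof *)

Lemma convex_roof_le (R : realType) d (V : set 'cV[R[i]]_d) (I : finType)
    (p : I -> R) (psi : I -> 'cV[R[i]]_d) :
  (forall i, 0 <= p i) -> \sum_i p i = 1 -> (forall i, unit_vector (psi i)) ->
  (convex_roof V (\sum_i (p i)%:C *: outer (psi i) (psi i))%R <=
    \sum_i (p i)%:E * gauge V (psi i) ^+ 2)%E.
Proof.
move=> p0 p1 psi1; apply: ereal_inf_lbound.
exists #|I|, (p \o enum_val), (psi \o enum_val); split => //.
- by move=> i /=.
- by rewrite (sum_enum_val p).
- by move=> i /=.
- by rewrite -(sum_enum_val (fun i => (p i)%:C *: outer (psi i) (psi i))).
- by rewrite -(sum_enum_val (fun i => (p i)%:E * gauge V (psi i) ^+ 2)%E).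
Qed.

Lemma S_nonempty (R : realType) d (V : set 'cV[R[i]]_d) :
  free_states V -> S_ V !=set0.
Proof. by case=> -[v Vv] _ _ _; exists (outer v v), v => //; exists v. Qed.

Lemma gauge_S_strongly_monotone (R : realType) d (V : set 'cV[R[i]]_d) :
  free_states V -> strongly_monotone_RNG V (gauge (S_ V)).
Proof.
move=> hV rho rhoD N K chK rngK.
apply: le_ereal_inf_tmp => _ [t [t0 rhot] <-].
have [I [c [a [c0 Sa KE ct]]]] :=
  S_decomposition_kraus hV chK (fun n => (rngK n).2) t0 rhot.
apply: (@le_trans _ _ (\sum_(n < N | prob (K n) rho != 0%R)
    (\sum_i c n i)%R%:E)%E).
  apply: lee_sum => n pn0.
  have pn : 0 < prob (K n) rho by rewrite lt_def pn0 prob_ge0.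
  apply: le_trans (gauge_pZ _ _ pn) _.
  rewrite scalerA -rmorphM divff// scale1r KE.
  by apply: gauge_le => //; exact: S_nonempty.
(* Outcomes of probability zero have nonnegative weight, so restoring them only enlarges the sum. *)
rewrite sumEFin lee_fin (le_trans _ ct)// [leRHS](bigID (fun n => prob (K n) rho != 0))/=.
by rewrite lerDl sumr_ge0// => n _; rewrite sumr_ge0.
Qed.

Lemma gauge_S_monotone (R : realType) d (V : set 'cV[R[i]]_d) :
  free_states V -> monotone_SRNG V (gauge (S_ V)).
Proof.
move=> hV rho _ L _ trL [N [K [LE coneK]]].
have chK : channel_kraus K.
  by apply: trace_preserving_channel => X; rewrite -LE trL.
apply: le_ereal_inf_tmp => _ [t [t0 rhot] <-].
have [I [c [a [c0 Sa KE ct]]]] := S_decomposition_kraus hV chK coneK t0 rhot.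
rewrite LE; under eq_bigr do rewrite KE.
(* The pairs of an outcome and an atom index a single decomposition of the output. *)
rewrite pair_bigA /=; apply: (@le_trans _ _ (\sum_p c p.1 p.2)%R%:E).
  by apply: gauge_le => //; exact: S_nonempty.
by rewrite lee_fin -(pair_bigA _ c).
Qed.

Lemma convex_roof_strongly_monotone (R : realType) d (V : set 'cV[R[i]]_d) :
  free_states V -> strongly_monotone_RNG V (convex_roof V).
Proof.
move=> hV rho rhoD N K chK rngK.
apply: le_ereal_inf_tmp => _ [k [p [psi [p0 p1 psi1 rhoE ->]]]].
have [q [phi [q0 phi1 KE qp qle]]] :=
  roof_decomposition_kraus hV chK (fun n => (rngK n).2) p0 psi1 rhoE.
(* The kets [phi n i] are unit vectors, so the trace is the total weight; dividing by it gives
   convex coefficients. *)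
have probE n : prob (K n) rho = \sum_i q n i.
  suff trE : \tr (kraus_map (K n) rho) = (\sum_i q n i)%:C by rewrite /prob trE.
  rewrite KE [LHS]raddf_sum [RHS]rmorph_sum; apply: eq_bigr => i _ /=.
  by rewrite mxtraceZ tr_outer; have /unit_vectorP -> := phi1 n i; rewrite mulr1.
have sq0 v : (0 <= gauge V v ^+ 2)%E by rewrite expe2 mule_ge0 ?gauge_ge0.
apply: le_trans qle; rewrite [leRHS](bigID (fun n => prob (K n) rho != 0))/=.
rewrite -[leLHS]adde0; apply: leeD; last first.
  by apply: sume_ge0 => n _; apply: sume_ge0 => i _; apply: mule_ge0; [rewrite lee_fin|exact: sq0].
apply: lee_sum => n pn0.
have pn : 0 < prob (K n) rho by rewrite lt_def pn0 prob_ge0.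
have -> : (prob (K n) rho)^-1%:C *: kraus_map (K n) rho =
    \sum_i ((prob (K n) rho)^-1 * q n i)%:C *: outer (phi n i) (phi n i).
  by rewrite KE scaler_sumr; apply: eq_bigr => i _; rewrite scalerA -rmorphM.
apply: le_trans (lee_wpmul2l _ (convex_roof_le _ _ _ (phi1 n))) _.
- by rewrite lee_fin ltW.
- by move=> i; rewrite mulr_ge0// invr_ge0 ltW.
- by rewrite -mulr_sumr -probE mulVf.
rewrite ge0_sume_distrr => [|i _]; last first.
  by rewrite mule_ge0// lee_fin mulr_ge0// invr_ge0 ltW.
by apply: lee_sum => i _; rewrite muleA -EFinM mulVKf.
Qed.

Lemma convex_roof_monotone (R : realType) d (V : set 'cV[R[i]]_d) :
  free_states V -> monotone_SRNG V (convex_roof V).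
Proof.
move=> hV rho _ L _ trL [N [K [LE coneK]]].
have chK : channel_kraus K.
  by apply: trace_preserving_channel => X; rewrite -LE trL.
apply: le_ereal_inf_tmp => _ [k [p [psi [p0 p1 psi1 rhoE ->]]]].
have [q [phi [q0 phi1 KE qp qle]]] :=
  roof_decomposition_kraus hV chK coneK p0 psi1 rhoE.
apply: le_trans qle; rewrite LE; under eq_bigr do rewrite KE.
rewrite !pair_bigA /=.
apply: (@convex_roof_le _ _ V _ (fun x => q x.1 x.2) (fun x => phi x.1 x.2)) => //.
(* Summing over the outcomes first recovers [p], so the merged weights have total 1. *)
rewrite -(pair_bigA _ q) exchange_big /= -p1.
by apply: eq_bigr => i _; rewrite qp.
Qed.

Theorem theorem19 (R : realType) (d : nat) (hd : (0 < d)%N)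
    (V : set 'cV[R[i]]_d) (hV : free_states V)
    (M : 'M[R[i]]_d -> \bar R)
    (hM : M = gauge (S_ V) \/ M = convex_roof V) :
  strongly_monotone_RNG V M /\ monotone_SRNG V M.
Proof.
case: hM => ->; split.
- exact: gauge_S_strongly_monotone.
- exact: gauge_S_monotone.
- exact: convex_roof_strongly_monotone.
- exact: convex_roof_monotone.
Qed.
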